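(* Let $(\mathrm D)$ be a projectively nonsingular system of degree $n$ and let $a\in\mathbb{R}$. The following statements are equivalent: (1) $(\mathrm D)$ has an equilibrium state at infinity lying on the ''extremities'' of the straight line $y=ax$; (2) the point $(\xi,\theta)=(a,0)$ is an equilibrium state of the first projectively reduced system $$\frac{d\xi}{d\tau}=\sum_{i=0}^n\theta^{n-i}W_i(1,\xi),\qquad \frac{d\theta}{d\tau}=-\theta\sum_{i=0}^n\theta^{n-i}X_i(1,\xi);$$ (3) $\xi=a$ is a solution of the equation $W_n(1,\xi)=0$.
   Context: System $(\mathrm D)$ of degree $n$: $\frac{dx}{dt}=X(x,y)=\sum_{k=0}^n X_k(x,y)$, $\frac{dy}{dt}=Y(x,y)=\sum_{k=0}^n Y_k(x,y)$, where $X_k,Y_k$ are real homogeneous polynomials of degree $k$, $X_n$ and $Y_n$ are not both identically zero, and $X,Y$ are relatively prime (no common divisors other than real numbers). Put $W_i(x,y)=xY_i(x,y)-yX_i(x,y)$, $i=0,\dots,n$. The system is projectively nonsingular if $W_n\not\equiv 0$ on $\mathbb{R}^2$. The projective phase plane $\mathbb{RP}(x,y)$ is the plane $(x,y)$ completed by the line at infinity, with charts $(x,y)$, $(\xi,\theta)=(\frac yx,\frac1x)$, $(\eta,\zeta)=(\frac1y,\frac xy)$; the trajectories in the chart $(\xi,\theta)$ are those of the first projectively reduced system, obtained from $(\mathrm D)$ by $x=\frac1\theta$, $y=\frac\xi\theta$ and removal of the common power of $\theta$ by a change of time. The point at infinity on the ''extremities'' of the line $y=ax$ is the point at infinity of this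 line, i.e. the point $(\xi,\theta)=(a,0)$. A point at infinity is an equilibrium state of $(\mathrm D)$ if it is an equilibrium of the field of trajectories so extended. *)

(* Defs.v *)
From HB Require Import structures.
From mathcomp Require Import all_boot all_order all_algebra.
From mathcomp Require Import mpoly.
From mathcomp Require Import reals.

Set Implicit Arguments.
Unset Strict Implicit.
Unset Printing Implicit Defensive.

Import Order.TTheory GRing.Theory Num.Theory.
Local Open Scope ring_scope.

(* The first coordinate is 'X_ord0, the second one is 'X_ord_max. *)
Definition coord (R : realType) (i : 'I_2) (p : R * R) : R :=
  if i == ord0 then p.1 else p.2.

Definition eval2 (R : realType) (P : {mpoly R[2]}) (p : R * R) : R :=
  P.@[fun i => coord i p].

Definition mdivides (R : realType) (d P : {mpoly R[2]}) : Prop :=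
  exists q : {mpoly R[2]}, P = d * q.

Definition relatively_prime (R : realType) (P Q : {mpoly R[2]}) : Prop :=
  forall d : {mpoly R[2]}, mdivides d P -> mdivides d Q ->
    exists c : R, d = c%:MP.

(* A component may vanish: 0 is k.-homog for every k. *)
Record system (R : realType) (n : nat) := System {
  Xc : 'I_n.+1 -> {mpoly R[2]};
  Yc : 'I_n.+1 -> {mpoly R[2]};
  Xc_homog : forall k : 'I_n.+1, Xc k \is (nat_of_ord k).-homog;
  Yc_homog : forall k : 'I_n.+1, Yc k \is (nat_of_ord k).-homog;
  top_neq0 : Xc ord_max != 0 \/ Yc ord_max != 0;
  coprimeXY : relatively_prime (\sum_(k < n.+1) Xc k) (\sum_(k < n.+1) Yc k)
}.

Section Fields.
Variables (R : realType) (n : nat) (S : system R n).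

Definition Xpoly : {mpoly R[2]} := \sum_(k < n.+1) Xc S k.
Definition Ypoly : {mpoly R[2]} := \sum_(k < n.+1) Yc S k.

Definition W (i : 'I_n.+1) : {mpoly R[2]} :=
  'X_ord0 * Yc S i - 'X_ord_max * Xc S i.

Definition projectively_nonsingular : Prop :=
  ~ (forall p : R * R, eval2 (W ord_max) p = 0).

(* A planar autonomous system is given by its right-hand side. *)
Definition equilibrium (f : R * R -> R * R) (p : R * R) : Prop :=
  f p = (0, 0).

Definition poly_field (F : {mpoly R[2]} * {mpoly R[2]}) (p : R * R) : R * R :=
  (eval2 F.1 p, eval2 F.2 p).

Definition affine_field : R * R -> R * R := poly_field (Xpoly, Ypoly).

Definition first_reduced_system (p : R * R) : R * R :=
  let: (xi, theta) := p in
  (\sum_(i < n.+1) theta ^+ (n - i) * eval2 (W i) (1, xi),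
   - theta * \sum_(i < n.+1) theta ^+ (n - i) * eval2 (Xc S i) (1, xi)).

(* The system in the coordinates (xi, theta) = (y / x, 1 / x), theta <> 0:
   xi' = (x y' - y x') / x ^ 2 and theta' = - x' / x ^ 2. *)
Definition field_xi_theta (p : R * R) : R * R :=
  let: (xi, theta) := p in
  let x := 1 / theta in
  let y := xi / theta in
  let X := eval2 Xpoly (x, y) in
  let Y := eval2 Ypoly (x, y) in
  ((x * Y - y * X) / x ^+ 2, - X / x ^+ 2).

(* The system in the coordinates (eta, zeta) = (1 / y, x / y), eta <> 0:
   eta' = - y' / y ^ 2 and zeta' = (y x' - x y') / y ^ 2. *)
Definition field_eta_zeta (p : R * R) : R * R :=
  let: (eta, zeta) := p in
  let x := zeta / eta in
  let y := 1 / eta in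
  let X := eval2 Xpoly (x, y) in
  let Y := eval2 Ypoly (x, y) in
  (- Y / y ^+ 2, (y * X - x * Y) / y ^+ 2).

(* F is obtained from f, a field defined where the i-th coordinate u is
   nonzero, by a change of time dt = u ^ k dtau (k of any sign) that makes it
   polynomial and leaves no common factor u. Such an F is unique; it extends
   the field of trajectories to the line u = 0. *)
Definition extends_after_time_change (i : 'I_2) (f : R * R -> R * R)
    (F : {mpoly R[2]} * {mpoly R[2]}) : Prop :=
  (exists k : int, forall p : R * R, coord i p != 0 ->
     poly_field F p = (coord i p ^ k * (f p).1, coord i p ^ k * (f p).2)) /\
  ~ (mdivides 'X_i F.1 /\ mdivides 'X_i F.2).

(* Homogeneous coordinates on RP(x, y); (x, y) is the point [x : y : 1].
   Points are given by representatives: all predicates below are invariant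
   under rescaling. *)
Record ppoint := PPoint {
  px : R;
  py : R;
  pz : R;
  ppoint_neq0 : (px, py, pz) != (0, 0, 0)
}.

Definition at_infinity (P : ppoint) : Prop := pz P = 0.

(* The projective closure of y = a x. *)
Definition on_line (a : R) (P : ppoint) : Prop := py P = a * px P.

(* P is an equilibrium of the extended field in one of the charts (x, y),
   (xi, theta), (eta, zeta) whose domain contains it. *)
Definition projective_equilibrium (P : ppoint) : Prop :=
  [\/ pz P != 0 /\ equilibrium affine_field (px P / pz P, py P / pz P),
      px P != 0 /\
      (exists2 F, extends_after_time_change ord_max field_xi_theta F &
         equilibrium (poly_field F) (py P / px P, pz P / px P))
    | py P != 0 /\
      (exists2 F, extends_after_time_change ord0 field_eta_zeta F &
         equilibrium (poly_field F) (pz P / py P, px P / py P))].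

Definition has_equilibrium_at_extremities (a : R) : Prop :=
  exists P : ppoint, [/\ at_infinity P, on_line a P & projective_equilibrium P].

End Fields.

(* Main.v *)
Require Import Defs.
From HB Require Import structures.
From mathcomp Require Import all_boot all_order all_algebra.
From mathcomp Require Import mpoly.
From mathcomp Require Import reals.
From mathcomp Require Import ring.

Set Implicit Arguments.
Unset Strict Implicit.
Unset Printing Implicit Defensive.

Import Defs.
Import Order.TTheory GRing.Theory Num.Theory.
Local Open Scope ring_scope.

(** Put u = theta (resp. u = eta) for the coordinate that vanishes on the line
at infinity. In each of the two charts at infinity, homogeneity of the
components shows that the field of the system, multiplied by u ^ (n - 1), is
polynomial ([xi_theta_time_change], [eta_zeta_time_change]). On the line u = 0
only the terms of top degree survive: the second component is zero and the
first is W_n(1, xi), in the chart (xi, theta); in the chart (eta, zeta) the two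
components are 0 and - W_n(zeta, 1). This gives the equivalence of (2) and (3).

The extension of the field to the line at infinity is a priori another
polynomial field F, reached by multiplying by another power of u. If G is the
field above then either G = u ^ m F with m >= 0, and an equilibrium of F is one
of G, or F = u ^ m G with m > 0, and u divides both components of F, which is
excluded ([extension_equilibrium]). An equilibrium at infinity on y = a x, in
whichever chart it is seen, thus yields W_n(1, a) = 0, through W_n(1 / a, 1) = 0
and homogeneity for the second chart.

Conversely, if W_n(1, a) = 0, the field G of the chart (xi, theta) vanishes at
(a, 0), and it is itself the extension: theta cannot divide its first
component, whose restriction W_n(1, xi) to theta = 0 is not identically zero for
a projectively nonsingular system ([W_top_neq0_at_infinity]).

The change of time is only required pointwise off the line u = 0. Two facts
pass from values to polynomials: polynomials that agree where u <> 0 agree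
everywhere ([eval2_eq_off_axis]), and a polynomial that vanishes where u = 0 is
divisible by u ([mdivides_coord]). *)

(** * Polynomials in two variables and their values *)

Section Evaluation.
Variable R : realType.
Implicit Types (P Q : {mpoly R[2]}) (p : R * R) (i : 'I_2).

Lemma eval2_0 p : eval2 (0 : {mpoly R[2]}) p = 0.
Proof. exact: meval0. Qed.

Lemma eval2_1 p : eval2 (1 : {mpoly R[2]}) p = 1.
Proof. exact: meval1. Qed.

Lemma eval2D P Q p : eval2 (P + Q) p = eval2 P p + eval2 Q p.
Proof. exact: mevalD. Qed.

Lemma eval2N P p : eval2 (- P) p = - eval2 P p.
Proof. exact: mevalN. Qed.

Lemma eval2M P Q p : eval2 (P * Q) p = eval2 P p * eval2 Q p.
Proof. exact: mevalM. Qed.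

Lemma eval2Xn P p k : eval2 (P ^+ k) p = eval2 P p ^+ k.
Proof. exact: rmorphXn. Qed.

Lemma eval2U i p : eval2 'X_i p = coord i p.
Proof. exact: mevalXU. Qed.

Lemma eval2_sum n (P : 'I_n -> {mpoly R[2]}) p :
  eval2 (\sum_(k < n) P k) p = \sum_(k < n) eval2 (P k) p.
Proof. exact: raddf_sum. Qed.

Lemma eval2_comp (A B P : {mpoly R[2]}) p :
  eval2 (P \mPo [tuple A; B]) p = eval2 P (eval2 A p, eval2 B p).
Proof.
rewrite /eval2 comp_mpoly_meval; apply: meval_eq => i.
by case: i => [[|[|]]] //=.
Qed.

Lemma eval2_dhomog d P c p : P \is d.-homog ->
  eval2 P (c * p.1, c * p.2) = c ^+ d * eval2 P p.
Proof.
move=> /dhomogP hP; rewrite /eval2 !mevalE mulr_sumr !big_seq.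
apply: eq_bigr => m /hP /= <-.
rewrite mulrCA mdegE -prodrXr -big_split /=; congr (_ * _).
apply: eq_bigr => i _; rewrite -exprMn; congr (_ ^+ _).
by rewrite /coord; case: ifP.
Qed.

Definition set_coord i p t : R * R := if i == ord0 then (t, p.2) else (p.1, t).

Lemma coord_set i p t : coord i (set_coord i p t) = t.
Proof. by rewrite /coord /set_coord; case: (i == ord0). Qed.

Lemma set_coord_id i p : set_coord i p (coord i p) = p.
Proof. by rewrite /coord /set_coord; case: (i == ord0); case: p. Qed.

Lemma coord_set_neq i j p t : j != i -> coord j (set_coord i p t) = coord j p.
Proof. by case: i => [[|[|]]] // ?; case: j => [[|[|]]]. Qed.

Lemma eval2_line P i p :
  exists q : {poly R}, forall t, q.[t] = eval2 P (set_coord i p t).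
Proof.
exists (mmap polyC (fun j => if j == i then 'X else (coord j p)%:P) P) => t.
rewrite /eval2 mevalE /mmap horner_sum; apply: eq_bigr => m _.
rewrite hornerM hornerC /mmap1 horner_prod; congr (_ * _).
apply: eq_bigr => j _; rewrite horner_exp.
by case: eqVneq => [->|ji]; rewrite ?coord_set ?coord_set_neq // !hornerE.
Qed.

Lemma poly_eq0_off0 (q : {poly R}) :
  (forall t, t != 0 -> q.[t] = 0) -> q = 0.
Proof.
move=> hq; apply: (@roots_geq_poly_eq0 _ _ [seq k.+1%:R | k <- iota 0 (size q)]).
- by apply/allP => _ /mapP[k _ ->]; apply/rootP/hq; rewrite pnatr_eq0.
- by rewrite map_inj_uniq ?iota_uniq // => k l /eqP; rewrite eqr_nat => /eqP[].
- by rewrite size_map size_iota.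
Qed.

(** Along a line in the direction of the i-th coordinate, the difference is a
polynomial in one variable that vanishes at every t <> 0, hence zero. *)
Lemma eval2_eq_off_axis P Q i :
  (forall p, coord i p != 0 -> eval2 P p = eval2 Q p) ->
  forall p, eval2 P p = eval2 Q p.
Proof.
move=> h p; have [q hq] := eval2_line (P - Q) i p.
have q0 : q = 0.
  apply: poly_eq0_off0 => t t0.
  by rewrite hq eval2D eval2N h ?subrr // coord_set.
apply/eqP; rewrite -subr_eq0 -eval2N -eval2D -[p in eval2 _ p](set_coord_id i).
by rewrite -hq q0 horner0.
Qed.

(** The monomials of P are sorted according to whether 'X_i divides them; those
that it does not divide form a polynomial q in the other variable. *)
Lemma mpoly_split_axis P i j : j != i ->
  exists Q (q : {poly R}), P = 'X_i * Q + (map_poly (@mpolyC 2 R) q).['X_j].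
Proof.
move=> ji; elim/mpolyind: P => [|c m P _ _ [Q [q ->]]].
  by exists 0, 0; rewrite mulr0 rmorph0 horner0 addr0.
have [mi0|mi0] := eqVneq (m i) 0%N.
  exists Q, (c *: 'X^(m j) + q).
  rewrite rmorphD /= hornerD map_polyZ map_polyXn hornerZ hornerXn.
  rewrite mul_mpolyC addrCA; congr (_ + (_ *: _ + _)).
  rewrite mpolyXE_id (bigD1 j) //= big1 ?mulr1 // => k kj.
  suff -> : k = i by rewrite mi0 expr0.
  by move: ji kj {mi0}; case: i j k => [[|[|]]] // ? [[|[|]]] // ? [[|[|]]] // ? _ _;
    apply: val_inj.
exists (c *: 'X_[m - U_(i)] + Q), q.
rewrite mulrDr addrA; congr (_ + _ + _).
rewrite -scalerAr -mpolyXD; congr (_ *: 'X_[_]).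
by rewrite addmC submK // lep1mP.
Qed.

(** In the splitting of [mpoly_split_axis], q is the restriction of P to the
axis, hence it is zero if P vanishes there. *)
Lemma mdivides_coord P i :
  mdivides 'X_i P <-> forall p, coord i p = 0 -> eval2 P p = 0.
Proof.
split=> [[Q ->] p p0|h]; first by rewrite eval2M eval2U p0 mul0r.
pose j := rev_ord i.
have ji : j != i by rewrite /j; case: i h @j => [[|[|]]].
have [Q [q defP]] := mpoly_split_axis P ji.
exists Q; rewrite defP.
suff -> : q = 0 by rewrite rmorph0 horner0 addr0.
apply: poly_eq0_off0 => t _.
have := h (set_coord i (t, t) 0) (coord_set _ _ _).
rewrite defP eval2D eval2M eval2U coord_set mul0r add0r /eval2 -horner_map.
rewrite /= mevalXU coord_set_neq // -map_poly_comp map_poly_id; last first.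
  by move=> x _ /=; rewrite mevalC.
by rewrite /coord; case: ifP.
Qed.

End Evaluation.

(** * Changes of time *)

Section TimeChange.
Variable R : realType.
Implicit Types (f : R * R -> R * R) (F G : {mpoly R[2]} * {mpoly R[2]}).

Definition time_change (i : 'I_2) f G (k : int) :=
  forall p : R * R, coord i p != 0 ->
     poly_field G p = (coord i p ^ k * (f p).1, coord i p ^ k * (f p).2).

(** Two changes of time of the same field differ by a power of the coordinate,
off the axis by definition and hence everywhere. *)
Lemma time_change_shift i f F G k (m : nat) :
  time_change i f F (k + m%:Z) -> time_change i f G k ->
  (forall q, eval2 F.1 q = coord i q ^+ m * eval2 G.1 q) /\
  (forall q, eval2 F.2 q = coord i q ^+ m * eval2 G.2 q).
Proof.
move=> hF hG.
have off q : coord i q != 0 ->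
    eval2 F.1 q = coord i q ^+ m * eval2 G.1 q /\
    eval2 F.2 q = coord i q ^+ m * eval2 G.2 q.
  move=> q0; have [-> ->] := hF q q0; have [-> ->] := hG q q0.
  by rewrite expfzDr // !mulrA ![_ ^+ _ * _]mulrC.
by split=> q; rewrite -eval2U -eval2Xn -eval2M;
  apply: (@eval2_eq_off_axis _ _ _ i) => r /off[? ?];
  rewrite eval2M eval2Xn eval2U.
Qed.

(** The reduced extension F has the least exponent of time change, so that G is
F times a nonnegative power of the coordinate. *)
Lemma extension_equilibrium i f F G k p :
  time_change i f G k -> extends_after_time_change i f F -> coord i p = 0 ->
  equilibrium (poly_field F) p -> equilibrium (poly_field G) p.
Proof.
move=> hG [[l hF] ndvd] p0 [F1p F2p].
have diff (x y : int) : x <= y -> exists m : nat, y = x + m%:Z.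
  by move=> xy; exists (absz (y - x)); rewrite gez0_abs ?subr_ge0 //; ring.
have [/diff[m kE]|lk] := lerP l k.
  rewrite kE in hG; have [G1 G2] := time_change_shift hG hF.
  by rewrite /equilibrium /poly_field G1 G2 F1p F2p mulr0.
(* l = k + (m + 1): the positive exponent makes F vanish on the whole axis. *)
have /diff[m lE] : k + 1 <= l by rewrite lezD1.
rewrite -addrA -[1 + _]/(m.+1%:Z) in lE.
rewrite lE in hF; have [F1 F2] := time_change_shift hF hG.
by case: ndvd; split; apply/mdivides_coord => q q0;
  rewrite ?F1 ?F2 q0 expr0n mul0r.
Qed.

End TimeChange.

(** * The charts at infinity *)

Section Charts.
Variables (R : realType) (n : nat) (S : system R n).

Lemma W_homog i : W S i \is i.+1.-homog.
Proof.
have hX j : 'X_j \is [in R[2], 1.-homog] by rewrite dhomogX /= mdeg1.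
by apply: rpredB; apply: (dhomogM (hX _)); [apply: Yc_homog|apply: Xc_homog].
Qed.

Lemma eval2_W i p : eval2 (W S i) p = p.1 * eval2 (Yc S i) p - p.2 * eval2 (Xc S i) p.
Proof. by rewrite eval2D eval2N !eval2M !eval2U. Qed.

Lemma sum_W p :
  eval2 (\sum_(i < n.+1) W S i) p =
  p.1 * eval2 (Ypoly S) p - p.2 * eval2 (Xpoly S) p.
Proof.
rewrite !eval2_sum !mulr_sumr -sumrB; apply: eq_bigr => i _; exact: eval2_W.
Qed.

(** Homogenization: a component of degree i + e at p / u is u ^ (- i - e) times
its value at p. *)
Lemma sum_homog_rescale (e : nat) (P : 'I_n.+1 -> {mpoly R[2]}) u p :
  (forall i : 'I_n.+1, P i \is (i + e).-homog) -> u != 0 ->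
  u ^+ (n + e) * eval2 (\sum_(i < n.+1) P i) (p.1 / u, p.2 / u) =
  \sum_(i < n.+1) u ^+ (n - i) * eval2 (P i) p.
Proof.
move=> hP u0; rewrite eval2_sum mulr_sumr; apply: eq_bigr => i _.
rewrite ![_ / u]mulrC (eval2_dhomog _ _ (hP i)) mulrA; congr (_ * _).
have -> : (n + e = (n - i) + (i + e))%N by rewrite addnA subnK // -ltnS.
by rewrite exprD -mulrA -exprMn mulfV // expr1n mulr1.
Qed.

(** The right-hand side of the first projectively reduced system, as a pair of
polynomials with ('X_ord0, 'X_ord_max) = (xi, theta). *)
Definition xi_theta_poly : {mpoly R[2]} * {mpoly R[2]} :=
  (\sum_(i < n.+1) 'X_ord_max ^+ (n - i) * (W S i \mPo [tuple 1; 'X_ord0]),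
   - 'X_ord_max *
     \sum_(i < n.+1) 'X_ord_max ^+ (n - i) * (Xc S i \mPo [tuple 1; 'X_ord0])).

(** The analogue in the chart ('X_ord0, 'X_ord_max) = (eta, zeta). *)
Definition eta_zeta_poly : {mpoly R[2]} * {mpoly R[2]} :=
  (- 'X_ord0 *
     \sum_(i < n.+1) 'X_ord0 ^+ (n - i) * (Yc S i \mPo [tuple 'X_ord_max; 1]),
   - \sum_(i < n.+1) 'X_ord0 ^+ (n - i) * (W S i \mPo [tuple 'X_ord_max; 1])).

Lemma xi_theta_polyE p : poly_field xi_theta_poly p = first_reduced_system S p.
Proof.
case: p => xi theta; rewrite /poly_field /=.
rewrite eval2M eval2N eval2U !eval2_sum.
by congr (_, _ * _); apply: eq_bigr => i _;
  rewrite eval2M eval2Xn eval2_comp !eval2U eval2_1.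
Qed.

Lemma eta_zeta_polyE eta zeta :
  poly_field eta_zeta_poly (eta, zeta) =
  (- eta * \sum_(i < n.+1) eta ^+ (n - i) * eval2 (Yc S i) (zeta, 1),
   - \sum_(i < n.+1) eta ^+ (n - i) * eval2 (W S i) (zeta, 1)).
Proof.
rewrite /poly_field /=.
rewrite eval2M !eval2N eval2U !eval2_sum.
by congr (_ * _, - _); apply: eq_bigr => i _;
  rewrite eval2M eval2Xn eval2_comp !eval2U eval2_1.
Qed.

Lemma W_homogD1 (i : 'I_n.+1) : W S i \is (i + 1).-homog.
Proof. by rewrite addn1 W_homog. Qed.

Lemma Xc_homogD0 (i : 'I_n.+1) : Xc S i \is (i + 0).-homog.
Proof. by rewrite addn0 Xc_homog. Qed.

Lemma Yc_homogD0 (i : 'I_n.+1) : Yc S i \is (i + 0).-homog.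
Proof. by rewrite addn0 Yc_homog. Qed.

Lemma expfzB1 (u : R) : u != 0 -> u ^ (n%:Z - 1) = u ^+ n / u.
Proof. by move=> u0; rewrite expfzDr // exprN1. Qed.

Lemma xi_theta_time_change :
  time_change ord_max (field_xi_theta S) xi_theta_poly (n%:Z - 1).
Proof.
move=> [xi theta]; rewrite xi_theta_polyE.
have -> : coord ord_max (xi, theta) = theta by [].
move=> th0; rewrite /first_reduced_system /field_xi_theta.
rewrite -(sum_homog_rescale (1, xi) W_homogD1 th0) sum_W.
rewrite -(sum_homog_rescale (1, xi) Xc_homogD0 th0) -/(Xpoly S).
rewrite addn1 addn0 exprS expfzB1 //.
by congr (_, _); cbn [fst snd]; field.
Qed.

Lemma eta_zeta_time_change :
  time_change ord0 (field_eta_zeta S) eta_zeta_poly (n%:Z - 1).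
Proof.
move=> [eta zeta]; rewrite eta_zeta_polyE.
have -> : coord ord0 (eta, zeta) = eta by [].
move=> et0; rewrite /field_eta_zeta.
rewrite -(sum_homog_rescale (zeta, 1) W_homogD1 et0) sum_W.
rewrite -(sum_homog_rescale (zeta, 1) Yc_homogD0 et0) -/(Ypoly S).
rewrite addn1 addn0 exprS expfzB1 //.
by congr (_, _); cbn [fst snd]; field.
Qed.

(** The term i = n is the only one left, since 0 ^+ 0 = 1. *)
Lemma sum_exp0 (E : 'I_n.+1 -> R) :
  \sum_(i < n.+1) 0 ^+ (n - i) * E i = E ord_max.
Proof.
rewrite (bigD1 ord_max) //= subnn mul1r big1 ?addr0 // => i ilt.
have iltn : (i < n)%N by rewrite ltn_neqAle -[(i <= n)%N]ltnS ltn_ord andbT.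
by rewrite expr0n subn_eq0 leqNgt iltn mul0r.
Qed.

Lemma first_reduced_system_infinity xi :
  first_reduced_system S (xi, 0) = (eval2 (W S ord_max) (1, xi), 0).
Proof. by rewrite /first_reduced_system sum_exp0 oppr0 mul0r. Qed.

Lemma W_top_rescale c p : c != 0 ->
  eval2 (W S ord_max) (c * p.1, c * p.2) = 0 <-> eval2 (W S ord_max) p = 0.
Proof.
move=> c0; rewrite (eval2_dhomog _ _ (W_homog _)); split=> [/eqP|->].
  by rewrite mulf_eq0 expf_eq0 (negPf c0) => /eqP.
by rewrite mulr0.
Qed.

(** By homogeneity, if W_n vanishes on the line x = 1 then it vanishes wherever
x <> 0, hence on the whole plane. *)
Lemma W_top_neq0_at_infinity :
  projectively_nonsingular S -> ~ (forall xi, eval2 (W S ord_max) (1, xi) = 0).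
Proof.
move=> hS W0; apply: hS => p; rewrite -[RHS](eval2_0 p).
apply: (@eval2_eq_off_axis _ _ _ ord0) => -[x y] x0; rewrite eval2_0.
have -> : (x, y) = (x * (1 : R, y / x).1, x * (1 : R, y / x).2).
  by rewrite /= mulr1 mulrC divfK.
exact/(W_top_rescale _ x0).
Qed.

Lemma xi_theta_extends : projectively_nonsingular S ->
  extends_after_time_change ord_max (field_xi_theta S) xi_theta_poly.
Proof.
move=> hS; split; first by exists (n%:Z - 1); apply: xi_theta_time_change.
case=> /mdivides_coord dvd _; apply: (W_top_neq0_at_infinity hS) => xi.
have /(_ erefl) := dvd (xi, 0).
by have [-> _] := xi_theta_polyE (xi, 0); rewrite sum_exp0.
Qed.

Lemma equilibrium_infinityE a :
  equilibrium (first_reduced_system S) (a, 0) <-> eval2 (W S ord_max) (1, a) = 0.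
Proof.
by rewrite /equilibrium first_reduced_system_infinity; split=> [[]|->].
Qed.

Lemma equilibrium_extremitiesE a : projectively_nonsingular S ->
  has_equilibrium_at_extremities S a <-> eval2 (W S ord_max) (1, a) = 0.
Proof.
move=> hS; split.
  case=> [[x y z nz]] []; rewrite /at_infinity /on_line /= => z0 yax.
  have x0 : x != 0.
    by apply: contraNneq nz => x0; rewrite z0 yax x0 mulr0.
  rewrite /projective_equilibrium /= z0 yax eqxx !mul0r mulfK //.
  case=> [[] //|[_ [F hF eqF]]|[ax0 [F hF eqF]]].
    apply/equilibrium_infinityE; rewrite /equilibrium -xi_theta_polyE.
    exact: (extension_equilibrium xi_theta_time_change hF).
  (* In the chart (eta, zeta) the point is (0, 1 / a), and the second component
     of the field is - W_n(1 / a, 1). *)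
  have [_] := @extension_equilibrium _ _ _ _ _ _ (0, x / (a * x))
    eta_zeta_time_change hF erefl eqF.
  have [_ ->] := eta_zeta_polyE 0 (x / (a * x)).
  rewrite sum_exp0 => /eqP; rewrite oppr_eq0 => /eqP.
  move: ax0; rewrite mulf_eq0 negb_or => /andP[a0 _] W0.
  apply/(W_top_rescale _ (c := a^-1)); first by rewrite invr_eq0.
  by rewrite /= mulr1 mulVf //; rewrite invfM mulrCA divff // mulr1 in W0.
move=> W0.
have nz : (1, a, 0) != (0, 0, 0) :> R * R * R by rewrite !xpair_eqE oner_eq0.
exists (PPoint nz); split; rewrite /at_infinity /on_line /= ?mulr1 //.
apply: Or32; rewrite /= oner_eq0; split=> //.
exists xi_theta_poly; first exact: xi_theta_extends.
by rewrite /equilibrium xi_theta_polyE !divr1; apply/equilibrium_infinityE.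
Qed.

End Charts.

Theorem mainTheorem14 (R : realType) (n : nat) (S : system R n) (a : R) :
  projectively_nonsingular S ->
  (has_equilibrium_at_extremities S a <->
     equilibrium (first_reduced_system S) (a, 0)) /\
  (equilibrium (first_reduced_system S) (a, 0) <->
     eval2 (W S ord_max) (1, a) = 0).
Proof.
move=> hS; split; last exact: equilibrium_infinityE.
by rewrite equilibrium_infinityE; apply: equilibrium_extremitiesE.
Qed.
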